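(* Let $\mathbb{S}$ and $\mathbb{T}$ be algebraic theories satisfying the following. (S1) For any two $\mathbb{S}$-terms $s_1,s_2$: if $s_1$ contains no variables and $s_1 =_{\mathbb{S}} s_2$, then $s_2$ contains no variables. (S2) For any $\mathbb{S}$-term $s$ and variable $x$: if $s =_{\mathbb{S}} x$, then $\{x\}\vdash s$. (S3) For every $n$-ary operation symbol $\phi_n$ ($n \geq 1$) of $\mathbb{S}$ there is a constant $e_\phi$ of $\mathbb{S}$ which acts as a unit for $\phi_n$: for each $k\le n$, substituting $e_\phi$ for $x_i$ for all $i \neq k$ ($i\le n$) in $\phi_n(x_1,\dots,x_n)$ gives a term provably equal in $\mathbb{S}$ to $x_k$. (S4a) $\mathbb{S}$ has a binary term $\mathbf{s}$ and a constant $e_{\mathbf{s}}$ with $\mathbf{s}(x,e_{\mathbf{s}}) =_{\mathbb{S}} x =_{\mathbb{S}} \mathbf{s}(e_{\mathbf{s}},x)$. (T1) For any two $\mathbb{T}$-terms $t_1,t_2$: if $t_1$ contains no variables and $t_1 =_{\mathbb{T}} t_2$, then $t_2$ contains no variables. (T2) For any $\mathbb{T}$-term $t$ and variable $y$: if $t =_{\mathbb{T}} y$, then $\{y\}\vdash t$. (T3), (T4) $\mathbb{T}$ has a constant $e_{\mathbf{t}}$ and a binary term $\mathbf{t}$ such that (a) $\mathbf{t}(y,e_{\mathbf{t}}) =_{\mathbb{T}} y =_{\mathbb{T}} \mathbf{t}(e_{\mathbf{t}},y)$, and (b) the abides equation does not hold: for all variables $y_1,y_2,y_3,y_4$, if $\mathbf{t}(\mathbf{t}(y_1,y_2),\mathbf{t}(y_3,y_4))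 =_{\mathbb{T}} \mathbf{t}(\mathbf{t}(y_1,y_3),\mathbf{t}(y_2,y_4))$ then the set $\{y_1,y_2,y_3,y_4\}$ has at most three elements. Then there does not exist a composite theory of $\mathbb{S}$ and $\mathbb{T}$.
   Context: An algebraic theory $\mathbb{T}$ consists of a signature $\Sigma^{\mathbb{T}}$ of finitary operation symbols (each with an arity in $\mathbb{N}$) and a set $E^{\mathbb{T}}$ of pairs of $\Sigma^{\mathbb{T}}$-terms (axioms), over an infinite supply of variables. A constant is a 0-ary term, i.e. a term containing no variables (for instance a 0-ary operation symbol). A binary term is a term in (at most) two variables, and $\mathbf{s}(a,b)$ denotes substitution of $a,b$ for these. $Y \vdash t$ (or $Y\vdash_{\mathbb{T}} t$) means that $t$ is a term (of $\mathbb{T}$) all of whose variables lie in $Y$. $t_1 =_{\mathbb{T}} t_2$ means the terms are provably equal from the axioms in (standard) equational logic. $t[s_i/x_i]$ denotes simultaneous substitution. Composite theory (separating as $\mathbb{T}$-terms of $\mathbb{S}$-terms): a composite of $\mathbb{S}$ and $\mathbb{T}$ is an algebraic theory $\mathbb{U}$ containing both $\mathbb{S}$ and $\mathbb{T}$ (their operations and axioms) such that: 1. Separation: every $\mathbb{U}$-term $u$ satisfies $u =_{\mathbb{U}} t[s_i/x_i]$ for some $\mathbb{T}$-term $t$ and $\mathbb{S}$-terms $s_i$. 2. Essential uniqueness: whenever $X \vdash_{\mathbb{T}} t$, $X' \vdash_{\mathbb{T}} t'$ and $Y_i\vdash_{\mathbb{S}} s_i$ (for $x_i\in X$), $Y'_{i'}\vdash_{\mathbb{S}}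 s'_{i'}$ (for $x'_{i'}\in X'$) are such that $t[s_i/x_i] =_{\mathbb{U}} t'[s'_{i'}/x'_{i'}]$, there are a set of variables $Z$ and functions $f: X \to Z$, $f': X' \to Z$ with: (a) $t[f(x_i)/x_i] =_{\mathbb{T}} t'[f'(x'_{i'})/x'_{i'}]$; (b) $f(x_i)=f(x_j) \Leftrightarrow s_i =_{\mathbb{S}} s_j$; (c) $f'(x'_{i'})=f'(x'_{j'}) \Leftrightarrow s'_{i'} =_{\mathbb{S}} s'_{j'}$; (d) $f(x_i)=f'(x'_{j'}) \Leftrightarrow s_i =_{\mathbb{S}} s'_{j'}$. *)

(* Defs.v *)
From mathcomp Require Import all_boot.

Set Implicit Arguments.
Unset Strict Implicit.
Unset Printing Implicit Defensive.

Definition var := nat.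

(* [Sg n] is the type of the [n]-ary operation symbols. *)
Definition signature := nat -> Type.

(* Arguments are Coq functions, so equality of terms is only meaningful up to
   pointwise equality of arguments; [prov_cong] below absorbs the difference. *)
Inductive term (Sg : signature) : Type :=
| Var (x : var)
| App (n : nat) (o : Sg n) (a : 'I_n -> term Sg).

Arguments Var {Sg} x.
Arguments App {Sg n} o a.

Fixpoint subst (Sg : signature) (sigma : var -> term Sg) (t : term Sg)
  : term Sg :=
  match t with
  | Var x => sigma x
  | App _ o a => App o (fun i => subst sigma (a i))
  end.

Fixpoint occurs (Sg : signature) (x : var) (t : term Sg) : Prop :=
  match t with
  | Var y => x = y
  | App _ _ a => exists i, occurs x (a i)
  end.

(* Y |- t *)
Definition in_context (Sg : signature) (Y : var -> Prop) (t : term Sg) : Prop :=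
  forall x, occurs x t -> Y x.

Definition constant_term (Sg : signature) (t : term Sg) : Prop :=
  forall x, ~ occurs x t.

(* The two variables of a binary term are fixed to be 0 and 1. *)
Definition binary (Sg : signature) (t : term Sg) : Prop :=
  in_context (fun x => x < 2) t.

Definition bin (Sg : signature) (t a b : term Sg) : term Sg :=
  subst (fun x => match x with 0 => a | 1 => b | _ => Var x end) t.

Record theory : Type := Theory {
  sig : signature;
  axiom : term sig -> term sig -> Prop
}.

Notation tm S := (term (sig S)).

Inductive provable (S : theory) : tm S -> tm S -> Prop :=
| prov_ax l r : axiom l r -> provable l r
| prov_refl t : provable t t
| prov_sym l r : provable l r -> provable r l
| prov_trans u v w : provable u v -> provable v w -> provable u w
| prov_cong n (o : sig S n) (a b : 'I_n -> tm S) :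
    (forall i, provable (a i) (b i)) -> provable (App o a) (App o b)
| prov_subst (sigma : var -> tm S) l r :
    provable l r -> provable (subst sigma l) (subst sigma r).

Notation "t1 =[ S ] t2" := (@provable S t1 t2)
  (at level 70, format "t1  =[ S ]  t2", no associativity).

Fixpoint translate (Sg Sg' : signature) (h : forall n, Sg n -> Sg' n)
    (t : term Sg) : term Sg' :=
  match t with
  | Var x => Var x
  | App n o a => App (h n o) (fun i => translate h (a i))
  end.

Record inclusion (S U : theory) : Type := Inclusion {
  incl_op : forall n, sig S n -> sig U n;
  incl_op_inj : forall n, injective (@incl_op n);
  incl_axiom : forall l r : tm S, axiom l r ->
    axiom (translate incl_op l) (translate incl_op r)
}.

Definition incl_tm (S U : theory) (i : inclusion S U) (t : tm S) : tm U :=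
  translate (incl_op i) t.

(* t[s_x/x], as a term of U, for a T-term t and S-terms s_x *)
Definition composite_tm (S T U : theory) (iS : inclusion S U)
    (iT : inclusion T U) (t : tm T) (s : var -> tm S) : tm U :=
  subst (fun x => incl_tm iS (s x)) (incl_tm iT t).

Definition rename (Sg : signature) (f : var -> var) (t : term Sg) : term Sg :=
  subst (fun x => Var (f x)) t.

Definition separation (S T U : theory) (iS : inclusion S U)
    (iT : inclusion T U) : Prop :=
  forall u : tm U, exists (t : tm T) (s : var -> tm S),
    u =[U] composite_tm iS iT t s.

(* Families indexed by X (and maps out of X) are total functions on variables
   whose values outside X are irrelevant. *)
Definition essential_uniqueness (S T U : theory) (iS : inclusion S U)
    (iT : inclusion T U) : Prop :=
  forall (X X' : var -> Prop) (t t' : tm T)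
         (Y Y' : var -> var -> Prop) (s s' : var -> tm S),
    in_context X t ->
    in_context X' t' ->
    (forall x, X x -> in_context (Y x) (s x)) ->
    (forall x', X' x' -> in_context (Y' x') (s' x')) ->
    composite_tm iS iT t s =[U] composite_tm iS iT t' s' ->
    exists (Z : var -> Prop) (f f' : var -> var),
      (forall x, X x -> Z (f x)) /\
      (forall x', X' x' -> Z (f' x')) /\
      rename f t =[T] rename f' t' /\
      (forall x y, X x -> X y -> (f x = f y <-> s x =[S] s y)) /\
      (forall x' y', X' x' -> X' y' -> (f' x' = f' y' <-> s' x' =[S] s' y')) /\
      (forall x y', X x -> X' y' -> (f x = f' y' <-> s x =[S] s' y')).

(* U-terms separate as T-terms of S-terms. *)
Definition composite (S T U : theory) (iS : inclusion S U)
    (iT : inclusion T U) : Prop :=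
  separation iS iT /\ essential_uniqueness iS iT.

(* Main.v *)
From Stdlib Require Import Setoid Morphisms.
Require Import Defs.
From mathcomp Require Import all_boot.

(** An S-operation applied to a T-constant is that constant: separate the
    result, send the other arguments to the unit of the operation, and use (T1)
    to see that the T-part has no variables.  Hence setting a variable to [e_t]
    in a separated term erases exactly the S-terms containing that variable,
    which identifies the S-terms in a separation of s(t(y0,y1),y2) and shows
    that s distributes over t on both sides.  Expanding s(t(y0,y1),t(y2,y3)) in
    the two possible orders then gives, by essential uniqueness, an instance of
    the abides equation whose four variables correspond to the pairwise distinct
    S-terms s(y0,y2), s(y0,y3), s(y1,y2), s(y1,y3). *)

Set Implicit Arguments.
Unset Strict Implicit.
Unset Printing Implicit Defensive.

#[local] Hint Resolve prov_refl : core.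

#[global] Instance provable_equivalence (S : theory) :
  Equivalence (@provable S).
Proof.
by split=> [x|x y|x y z]; [apply: prov_refl|apply: prov_sym|apply: prov_trans].
Qed.

(** * Substitution and occurrence *)

Lemma subst_ext (S : theory) (sigma tau : var -> tm S) (t : tm S) :
  (forall x, occurs x t -> sigma x =[S] tau x) ->
  subst sigma t =[S] subst tau t.
Proof.
elim: t => [x|n o a IH] /= eq_st; first exact: eq_st.
by apply: prov_cong => i; apply: IH => x xa; apply: eq_st; exists i.
Qed.

Lemma subst_subst (S : theory) (sigma tau : var -> tm S) (t : tm S) :
  subst sigma (subst tau t) =[S] subst (fun x => subst sigma (tau x)) t.
Proof. by elim: t => [x|n o a IH] //=; apply: prov_cong. Qed.

Lemma subst_fixed (S : theory) (sigma : var -> tm S) (t : tm S) :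
  (forall x, occurs x t -> sigma x =[S] Var x) -> subst sigma t =[S] t.
Proof.
move=> fix_s; apply: prov_trans (subst_ext fix_s) _.
by elim: {fix_s} t => [x|n o a IH] //=; apply: prov_cong.
Qed.

Lemma subst_constant (S : theory) (sigma : var -> tm S) (t : tm S) :
  constant_term t -> subst sigma t =[S] t.
Proof. by move=> ct; apply: subst_fixed => x /ct. Qed.

Lemma occurs_subst (Sg : signature) (sigma : var -> term Sg) (t : term Sg) x y :
  occurs y t -> occurs x (sigma y) -> occurs x (subst sigma t).
Proof.
move=> + xs; elim: t => [z|n o a IH] /= => [<- //|[i yi]].
by exists i; apply: IH.
Qed.

Lemma occurs_substV (Sg : signature) (sigma : var -> term Sg) (t : term Sg) x :
  occurs x (subst sigma t) -> exists2 y, occurs y t & occurs x (sigma y).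
Proof.
elim: t => [z xz|n o a IH /= [i /IH[y ya xy]]]; first by exists z.
by exists y => //; exists i.
Qed.

Lemma rename_constant (Sg : signature) (f : var -> var) (t : term Sg) :
  constant_term (rename f t) <-> constant_term t.
Proof.
split=> ct x; first by move=> xt; apply: (ct (f x)); exact: occurs_subst xt _.
by case/occurs_substV => y /ct.
Qed.

(** A Boolean test lets a substitution branch on whether a variable occurs. *)
Fixpoint occursb (Sg : signature) (x : var) (t : term Sg) : bool :=
  match t with
  | Var y => x == y
  | App _ _ a => [exists i, occursb x (a i)]
  end.

Lemma occursP (Sg : signature) (x : var) (t : term Sg) :
  reflect (occurs x t) (occursb x t).
Proof.
elim: t => [y|n o a IH] /=; first exact: eqP.
by apply: (iffP existsP) => -[i /IH]; exists i.
Qed.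

#[global] Instance subst_proper (S : theory) (sigma : var -> tm S) :
  Proper (@provable S ==> @provable S) (subst sigma).
Proof. by move=> l r; apply: prov_subst. Qed.

#[global] Instance bin_proper (S : theory) (t : tm S) :
  Proper (@provable S ==> @provable S ==> @provable S) (bin t).
Proof. by move=> a a' aa' b b' bb'; apply: subst_ext => -[|[|x]]. Qed.

Lemma subst_bin (S : theory) (sigma : var -> tm S) (t a b : tm S) :
  binary t -> subst sigma (bin t a b) =[S] bin t (subst sigma a) (subst sigma b).
Proof.
move=> bt; apply: prov_trans (subst_subst _ _ _) _.
by apply: subst_ext => -[|[|x]] // /bt.
Qed.

Lemma bin_vars (S : theory) (t : tm S) :
  binary t -> bin t (Var 0) (Var 1) =[S] t.
Proof. by move=> bt; apply: subst_fixed => -[|[|x]]. Qed.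

(** * Terms of an included theory *)

Section Inclusion.

Variables (S U : theory) (i : inclusion S U).

Lemma incl_subst (sigma : var -> tm S) (t : tm S) :
  incl_tm i (subst sigma t)
    =[U] subst (fun x => incl_tm i (sigma x)) (incl_tm i t).
Proof. by elim: t => [x|n o a IH] //=; apply: prov_cong. Qed.

Lemma incl_provable (l r : tm S) : l =[S] r -> incl_tm i l =[U] incl_tm i r.
Proof.
elim=> {l r} [l r /(incl_axiom i)|||u v w _ + _|n o a b _ IH|sigma l r _ IH] //.
- exact: prov_ax.
- by move=> l r _; apply: prov_sym.
- exact: prov_trans.
- exact: prov_cong.
- by rewrite !incl_subst; apply: prov_subst.
Qed.

Lemma occurs_incl (x : var) (t : tm S) : occurs x (incl_tm i t) <-> occurs x t.
Proof. by elim: t => [y|n o a IH] //=; split=> -[j /IH]; exists j. Qed.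

Lemma incl_constant (t : tm S) : constant_term t -> constant_term (incl_tm i t).
Proof. by move=> ct x /occurs_incl/ct. Qed.

Lemma incl_binary (t : tm S) : binary t -> binary (incl_tm i t).
Proof. by move=> bt x /occurs_incl/bt. Qed.

Lemma incl_bin (t a b : tm S) :
  incl_tm i (bin t a b) =[U] bin (incl_tm i t) (incl_tm i a) (incl_tm i b).
Proof. by rewrite /bin incl_subst; apply: subst_ext => -[|[|x]]. Qed.

End Inclusion.

Lemma bin_unitr (S U : theory) (i : inclusion S U) (t e : tm S) (a : tm U) :
  binary t -> constant_term e -> bin t (Var 0) e =[S] Var 0 ->
  bin (incl_tm i t) a (incl_tm i e) =[U] a.
Proof.
move=> bt ce /(incl_provable i)/(prov_subst (fun=> a)).
rewrite incl_bin subst_bin; last exact: incl_binary.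
by rewrite (subst_constant _ (incl_constant ce)).
Qed.

Lemma bin_unitl (S U : theory) (i : inclusion S U) (t e : tm S) (a : tm U) :
  binary t -> constant_term e -> bin t e (Var 0) =[S] Var 0 ->
  bin (incl_tm i t) (incl_tm i e) a =[U] a.
Proof.
move=> bt ce /(incl_provable i)/(prov_subst (fun=> a)).
rewrite incl_bin subst_bin; last exact: incl_binary.
by rewrite (subst_constant _ (incl_constant ce)).
Qed.

(** * Composite theories *)

Section Composite.

Variables (S T U : theory) (iS : inclusion S U) (iT : inclusion T U).
Hypothesis compU : composite iS iT.

Local Notation comp := (composite_tm iS iT).
Local Notation inS := (incl_tm iS).
Local Notation inT := (incl_tm iT).

(** Taking every context to be the set of all variables makes the context conditions trivial. *)
Lemma composite_uniq (t t' : tm T) (s s' : var -> tm S) :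
  comp t s =[U] comp t' s' ->
  exists f f' : var -> var,
    [/\ rename f t =[T] rename f' t',
        forall x y, f x = f y <-> s x =[S] s y
      & forall x y, f x = f' y <-> s x =[S] s' y].
Proof.
move=> eq_tt'; have [_ /(_ (fun=> True) (fun=> True) t t')] := compU.
case/(_ (fun _ _ => True) (fun _ _ => True) s s') => //.
move=> Z [f [f' [_ [_ [eq_ff' [fE [_ ff'E]]]]]]]; exists f, f'.
by split=> // x y; [apply: fE|apply: ff'E].
Qed.

Lemma comp_subst (t : tm T) (delta : var -> tm T) (s : var -> tm S) :
  comp (subst delta t) s =[U] subst (fun x => comp (delta x) s) (inT t).
Proof. by rewrite /composite_tm incl_subst subst_subst. Qed.

Lemma subst_comp (t : tm T) (tau s : var -> tm S) :
  subst (fun x => inS (tau x)) (comp t s)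
    =[U] comp t (fun x => subst tau (s x)).
Proof.
rewrite /composite_tm subst_subst; apply: subst_ext => x _.
by rewrite incl_subst.
Qed.

Lemma comp_vars (t : tm T) : comp t (fun x => Var x) =[U] inT t.
Proof. by apply: subst_fixed. Qed.

Lemma comp_constant (t : tm T) (s : var -> tm S) :
  constant_term t -> comp t s =[U] inT t.
Proof. by move=> ct; apply/subst_constant/incl_constant. Qed.

Lemma comp_bin (t a b : tm T) (s : var -> tm S) :
  binary t -> comp (bin t a b) s =[U] bin (inT t) (comp a s) (comp b s).
Proof.
move=> bt; rewrite comp_subst.
by apply: subst_ext => -[|[|x]] // /occurs_incl/bt.
Qed.

Hypothesis S2 : forall (s : tm S) (x : var),
  s =[S] Var x -> in_context (fun z => z = x) s.
Hypothesis S3 : forall (n : nat) (phi : sig S n), 1 <= n ->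
  exists e : tm S, constant_term e /\
    forall k : 'I_n,
      subst (fun x => if x == k :> nat then Var x else e)
            (App phi (fun i : 'I_n => Var i)) =[S] Var k.
Hypothesis T1 : forall t1 t2 : tm T,
  constant_term t1 -> t1 =[T] t2 -> constant_term t2.
Hypothesis T2 : forall (t : tm T) (y : var),
  t =[T] Var y -> in_context (fun z => z = y) t.

(** * Absorption by constants of [T] *)

Lemma comp_eq_constant (c t : tm T) (s : var -> tm S) :
  constant_term c -> comp t s =[U] inT c -> constant_term t /\ t =[T] c.
Proof.
move=> cc; rewrite -comp_vars => /composite_uniq[f [f' [eq_tc _ _]]].
have ct : constant_term t.
  apply/(rename_constant f); apply: T1 (prov_sym eq_tc).
  exact/rename_constant.
split=> //.
by move: eq_tc; rewrite /rename !subst_constant.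
Qed.

Lemma op_zero (n : nat) (phi : sig S n) (a : 'I_n -> tm U) (k : 'I_n)
    (c : tm T) :
  constant_term c -> a k =[U] inT c ->
  App (incl_op iS phi) a =[U] inT c.
Proof.
move=> cc ak; have n_gt0 : 0 < n by case: n k {phi a ak} => [[]|].
have [e [ce /(_ k) unit_e]] := S3 phi n_gt0.
(* The generic case: [c] in position [k] and distinct variables elsewhere. The given [a] is an
   instance of it, via [rho] below. *)
pose b := App (incl_op iS phi)
  (fun j : 'I_n => if j == k then inT c else Var j).
have [t [s b_ts]] := compU.1 b.
pose tau x := if x == k :> nat then Var x else e.
have b_tau : subst (fun x => inS (tau x)) b =[U] inT c.
  (* This is the unit law at position [k] with [c] substituted for its variable; the constants [e]
     are unaffected. *)
  have := prov_subst (fun=> inT c) (incl_provable iS unit_e).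
  apply: prov_trans; apply: prov_cong => j.
  have tauE : tau j = if j == k then Var j else e by [].
  change (subst (fun x => inS (tau x)) (if j == k then inT c else Var j)
    =[U] subst (fun=> inT c) (inS (tau j))); rewrite tauE.
  case jk: (j == k); first exact/subst_constant/incl_constant.
  by rewrite /= tauE jk; apply/prov_sym/subst_constant/incl_constant.
have [ct tc] : constant_term t /\ t =[T] c.
  apply: (comp_eq_constant (s := fun x => subst tau (s x))) => //.
  by rewrite -subst_comp -b_ts.
have bc : b =[U] inT c by rewrite b_ts comp_constant // (incl_provable _ tc).
pose rho x := if insub x is Some j then a j else Var x.
rewrite -(subst_constant rho (incl_constant cc)) -(prov_subst rho bc).
apply: prov_cong => j; case: eqP => [->|_] /=.
  by apply: prov_trans ak _; exact/prov_sym/subst_constant/incl_constant.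
by rewrite /rho [insub _](valK j).
Qed.

Lemma term_zero (s : tm S) (y : var) (sigma : var -> tm U) (c : tm T) :
  constant_term c -> occurs y s -> sigma y =[U] inT c ->
  subst sigma (inS s) =[U] inT c.
Proof.
move=> cc + sy; elim: s => [x /= <- //|n o a IH /= [j /IH]].
exact: op_zero.
Qed.

(** By [term_zero], the substitution turns every [s x] containing [y] into [c], so [delta] can
    perform it inside the T-part. Comparing the result with [r], separated with a single variable as
    T-part, makes the new T-part a variable up to renaming. By (T2) all surviving variables are then
    sent to that one, so their S-terms equal [r]. *)
Lemma erase_var (t c : tm T) (s : var -> tm S) (r : tm S) (y : var) :
  constant_term c ->
  subst (fun x => if x == y then inT c else Var x) (comp t s) =[U] inS r ->
  forall x, occurs x t -> ~ occurs y (s x) -> s x =[S] r.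
Proof.
move=> cc; set sigma := fun x => _.
pose delta x := if occursb y (s x) then c else Var x.
have -> : subst sigma (comp t s) =[U] comp (subst delta t) s.
  rewrite comp_subst subst_subst; apply: subst_ext => x _.
  rewrite /delta; case: occursP => [ysx|nysx].
    rewrite comp_constant //; apply: term_zero ysx _ => //.
    by rewrite /sigma eqxx.
  apply: subst_fixed => z /occurs_incl zsx; rewrite /sigma.
  by case: eqP => // zy; case: nysx; rewrite -zy.
move=> eq_r.
have /composite_uniq[f [f' [/T2 eq_f _ ff']]] :
  comp (subst delta t) s =[U] comp (Var 0) (fun=> r) by [].
move=> x xt nysx; apply/ff'; apply: eq_f.
apply: (@occurs_subst _ _ _ _ x) => //; apply: occurs_subst xt _.
by rewrite /delta; case: occursP.
Qed.

(** It suffices to treat variables. Units substituted into a separation of the left side determine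
    first the shape of its T-part [p], then its S-terms. *)
Lemma distributive (t et : tm T) (s es : tm S) (a b c : tm U) :
  binary t -> constant_term et ->
  bin t (Var 0) et =[T] Var 0 -> bin t et (Var 0) =[T] Var 0 ->
  binary s -> constant_term es -> bin s (Var 0) es =[S] Var 0 ->
  bin (inS s) (bin (inT t) a b) c
    =[U] bin (inT t) (bin (inS s) a c) (bin (inS s) b c).
Proof.
move=> bt cet tr tl bs ces sr.
have bt' : binary (incl_tm iT t) := incl_binary bt.
have bs' : binary (incl_tm iS s) := incl_binary bs.
pose u := bin (inS s) (bin (inT t) (Var 0) (Var 1)) (Var 2).
pose v0 := bin s (Var 0) (Var 2); pose v1 := bin s (Var 1) (Var 2).
suff uE : u =[U] bin (inT t) (inS v0) (inS v1).
  pose sigma x := match x with 0 => a | 1 => b | _ => c end.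
  have := prov_subst sigma uE.
  by rewrite /u !incl_bin !subst_bin.
have [p [r u_pr]] := compU.1 u.
(* Setting variable 2 to the unit [es] collapses [u] to [t], so [p] agrees with [t] up to
   renaming. *)
pose tau x := if x == 2 then es else Var x.
have pt : comp t (fun x => Var x) =[U] comp p (fun x => subst tau (r x)).
  rewrite comp_vars -subst_comp -u_pr /u !subst_bin //=.
  by rewrite (bin_unitr _ _ bs ces sr) bin_vars.
have [f [f' [ff'_tp f_eq ff'_eq]]] := composite_uniq pt.
have f01 : f 0 <> f 1 by move/f_eq/S2/(_ 0 erefl).
have renE : rename f t =[T] bin t (Var (f 0)) (Var (f 1)).
  by apply: subst_ext => -[|[|x]] // /bt.
(* Setting the variable [f 1] to [et] turns t into a variable, so by (T2) no
   third variable survives in the T-part of the separation. *)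
have f'01 x : occurs x p -> f' x = f 0 \/ f' x = f 1.
  move=> xp; case: (f' x =P f 1) => [|f'x1]; [by right|left].
  pose rho z := if z == f 1 then et else Var z.
  have : subst rho (rename f' p) =[T] Var (f 0).
    rewrite -ff'_tp renE subst_bin // /= /rho eqxx; case: eqP => // _.
    have := prov_subst (fun=> Var (f 0)) tr.
    by rewrite subst_bin // (subst_constant _ cet).
  move/T2; apply; apply: (@occurs_subst _ _ _ _ (f' x)).
    exact: occurs_subst xp _.
  by rewrite /rho; case: eqP.
(* If [f' x = f y], then [r x] becomes provably [Var y] once variable 2 is erased, so by (S2) it
   contains no variables other than [y] and 2. *)
have r_fresh x y j : j != 2 -> j <> y -> f' x = f y -> ~ occurs j (r x).
  move=> j2 jy /esym/ff'_eq/prov_sym/S2 only_y jr; apply: jy; apply: only_y.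
  by apply: occurs_subst jr _; rewrite /tau (negbTE j2).
(* Setting variable 1 to [et] reduces [u] to [v0], and [r x] is among the S-terms not erased, as it
   avoids 1. *)
have r0 x : occurs x p -> f' x = f 0 -> r x =[S] v0.
  move=> xp f'x; apply: (@erase_var p et r v0 1) => //; last exact: r_fresh f'x.
  rewrite -u_pr /u !subst_bin //= incl_bin.
  by rewrite (bin_unitr _ _ bt cet tr).
have r1 x : occurs x p -> f' x = f 1 -> r x =[S] v1.
  move=> xp f'x; apply: (@erase_var p et r v1 0) => //; last exact: r_fresh f'x.
  rewrite -u_pr /u !subst_bin //= incl_bin.
  by rewrite (bin_unitl _ _ bt cet tl).
(* The S-term [r x] depends only on [f' x], so [comp p r] factors through [rename f' p], which can
   be exchanged for [rename f t]. *)
pose w z := if z == f 0 then inS v0 else inS v1.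
rewrite u_pr; have -> : comp p r =[U] subst w (inT (rename f' p)).
  rewrite incl_subst subst_subst; apply: subst_ext => x /occurs_incl xp /=.
  rewrite /w; case: eqP => [/(r0 x xp)|]; first exact: incl_provable.
  by case: (f'01 x xp) => // /(r1 x xp) + _; apply: incl_provable.
rewrite -(incl_provable iT ff'_tp) (incl_provable iT renE) incl_bin subst_bin //=.
by rewrite /w eqxx; case: eqP => [/esym|].
Qed.

End Composite.

(** * Two-sided distributivity against the failure of abides *)

Theorem theorem4p17 (S T : theory)
  (S1 : forall s1 s2 : tm S, constant_term s1 -> s1 =[S] s2 -> constant_term s2)
  (S2 : forall (s : tm S) (x : var),
      s =[S] Var x -> in_context (fun z => z = x) s)
  (S3 : forall (n : nat) (phi : sig S n), 1 <= n ->
      exists e : tm S, constant_term e /\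
        forall k : 'I_n,
          subst (fun x => if x == k :> nat then Var x else e)
                (App phi (fun i : 'I_n => Var i)) =[S] Var k)
  (S4a : exists s e : tm S, binary s /\ constant_term e /\
      forall x : var,
        bin s (Var x) e =[S] Var x /\ Var x =[S] bin s e (Var x))
  (T1 : forall t1 t2 : tm T, constant_term t1 -> t1 =[T] t2 -> constant_term t2)
  (T2 : forall (t : tm T) (y : var),
      t =[T] Var y -> in_context (fun z => z = y) t)
  (T34 : exists t e : tm T, binary t /\ constant_term e /\
      (forall y : var,
        bin t (Var y) e =[T] Var y /\ Var y =[T] bin t e (Var y)) /\
      (forall y1 y2 y3 y4 : var,
        bin t (bin t (Var y1) (Var y2)) (bin t (Var y3) (Var y4))
          =[T] bin t (bin t (Var y1) (Var y3)) (bin t (Var y2) (Var y4)) ->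
        size (undup [:: y1; y2; y3; y4]) <= 3)) :
  ~ exists (U : theory) (iS : inclusion S U) (iT : inclusion T U),
      composite iS iT.

Proof.
case=> [U [iS [iT compU]]].
have [s [es [bs [ces sU]]]] := S4a; have [sr sl] := sU 0.
have [t [et [bt [cet [tU abides]]]]] := T34; have [tr tl] := tU 0.
move/prov_sym in sl; move/prov_sym in tl.
(* Distributivity in the second argument of [s] is distributivity in the first argument of its
   opposite [q]. *)
pose q := bin s (Var 1) (Var 0).
have bq : binary q.
  by move=> x /occurs_substV[[|[|y]] /bs //= _ ->].
have qE (V : theory) (i : inclusion S V) a b :
    bin (incl_tm i q) a b =[V] bin (incl_tm i s) b a.
  pose sigma (x : var) := match x with 0 => a | 1 => b | _ => Var x end.
  have := prov_subst sigma (incl_bin i s (Var 1) (Var 0)).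
  by rewrite subst_bin //; apply: incl_binary.
have qr : bin q (Var 0) es =[S] Var 0.
  by rewrite /q {1}/bin subst_bin.
have distl a b c : bin (incl_tm iS s) (bin (incl_tm iT t) a b) c =[U]
    bin (incl_tm iT t) (bin (incl_tm iS s) a c) (bin (incl_tm iS s) b c).
  exact: (distributive compU S2 S3 T1 T2) sr.
have distr a b c : bin (incl_tm iS s) c (bin (incl_tm iT t) a b) =[U]
    bin (incl_tm iT t) (bin (incl_tm iS s) c a) (bin (incl_tm iS s) c b).
  have := distributive compU S2 S3 T1 T2 a b c bt cet tr tl bq ces qr.
  by rewrite !qE.
(* The binary digits of [x] < 4 choose the arguments: [v] lists s(0,2), s(0,3), s(1,2), s(1,3). *)
pose v (x : var) := bin s (Var x./2) (Var (2 + odd x)).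
have vE x : incl_tm iS (v x) =[U]
    bin (incl_tm iS s) (Var x./2) (Var (2 + odd x)).
  exact: incl_bin.
pose quad (w x y z : var) : tm T :=
  bin t (bin t (Var w) (Var x)) (bin t (Var y) (Var z)).
have quadE w x y z : composite_tm iS iT (quad w x y z) v =[U]
    bin (incl_tm iT t)
      (bin (incl_tm iT t) (incl_tm iS (v w)) (incl_tm iS (v x)))
      (bin (incl_tm iT t) (incl_tm iS (v y)) (incl_tm iS (v z))).
  by rewrite !comp_bin.
(* Both sides expand s(t(0,1),t(2,3)): the left one splits the first argument of s first, the right
   one the second. *)
have : composite_tm iS iT (quad 0 1 2 3) v
    =[U] composite_tm iS iT (quad 0 2 1 3) v.
  rewrite !quadE !vE /= -!distr -!distl distr.
  by rewrite distl.
case/(composite_uniq compU) => f [f' [eq_ff' f_eq ff'_eq]].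
have ff' x : f' x = f x by apply/esym/ff'_eq.
have renE g w x y z : rename g (quad w x y z) =[T] quad (g w) (g x) (g y) (g z).
  by rewrite /rename !subst_bin.
(* Replacing either argument of s by the unit [es] recovers one binary digit of the index. *)
have v_inj x y : x < 4 -> y < 4 -> v x =[S] v y -> x = y.
  have fst_var z : z < 4 ->
      subst (fun k => if k < 2 then Var k else es) (v z) =[S] Var z./2.
    by move=> z4; rewrite subst_bin //= ltn_half_double z4; apply: (sU _).1.
  have snd_var z : z < 4 ->
      subst (fun k => if k < 2 then es else Var k) (v z) =[S] Var (2 + odd z).
    move=> z4; rewrite subst_bin //= ltn_half_double z4.
    exact/prov_sym/(sU _).2.
  move=> x4 y4 vxy; rewrite -(odd_double_half x) -(odd_double_half y).
  have -> : x./2 = y./2.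
    have : Var x./2 =[S] Var y./2 by rewrite -!fst_var // vxy.
    by move/S2; apply.
  suff /addnI-> : 2 + odd x = 2 + odd y by [].
  have : Var (2 + odd x) =[S] Var (2 + odd y) by rewrite -!snd_var // vxy.
  by move/S2; apply.
have f_inj x y : x < 4 -> y < 4 -> f x = f y -> x = y.
  by move=> x4 y4 /f_eq/v_inj; apply.
(* The instance of abides holds at four values of [f] that are pairwise distinct by [f_inj], so the
   bound 3 fails. *)
have := abides (f 0) (f 1) (f 2) (f 3).
rewrite -[X in X =[T] _]/(quad _ _ _ _) -[X in _ =[T] X]/(quad _ _ _ _).
rewrite -renE eq_ff' renE !ff' => /(_ (prov_refl _)).
rewrite -[[:: f 0; _; _; _]]/(map f (iota 0 4)) undup_id //.
rewrite map_inj_in_uniq ?iota_uniq // => x y; rewrite !mem_iota.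
exact: f_inj.
Qed.
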